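(* Let $A\in\mathbb{C}^{n\times n}$, $B\in\mathbb{C}^{n\times m}$, $C\in\mathbb{C}^{p\times n}$, $D\in\mathbb{C}^{p\times m}$, and let $1\le k\le m$ be an integer. Consider the semidefinite program (P): maximize $$\mathrm{Tr}\left(\begin{bmatrix} C^*C & C^*D \\ D^*C & D^*D \end{bmatrix}\begin{bmatrix} X & R \\ R^* & W \end{bmatrix}\right)$$ over $X\in\mathbb{C}^{n\times n}$, $R\in\mathbb{C}^{n\times m}$, $W\in\mathbb{C}^{m\times m}$ subject to $$X=\begin{bmatrix} A & B \end{bmatrix}\begin{bmatrix} X & R \\ R^* & W \end{bmatrix}\begin{bmatrix} A^* \\ B^* \end{bmatrix},\quad \mathrm{Tr}(W)\le1,\quad \mathbf{1}^T|W|\mathbf{1}\le k,\quad \begin{bmatrix} X & R \\ R^* & W \end{bmatrix}\succeq0.$$ Its Lagrangian dual is the program (D): minimize $\lambda+k\,t$ over $P=P^*\in\mathbb{C}^{n\times n}$, $Y=Y^*\in\mathbb{C}^{m\times m}$, $\lambda\ge0$, $t\ge0$ subject to $$\begin{bmatrix} A^*PA-P & A^*PB \\ B^*PA & B^*PB-\lambda I-Y \end{bmatrix}+\begin{bmatrix} C^*C & C^*D \\ D^*C & D^*D \end{bmatrix}\preceq0,\qquad |Y|\le t\,\mathbf{1}\mathbf{1}^T .$$ If $A$ is stable (spectral radius $\rho(A)<1$), then (D) is strictly feasible and the duality gap is zero, i.e. the optimal values of (P) and (D) are equal.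
   Context: For a matrix $W$, $|W|$ denotes the entrywise absolute value (modulus), and $\mathbf{1}$ the all-ones vector; the inequality $|Y|\le t\mathbf{1}\mathbf{1}^T$ is entrywise, while $\preceq,\succeq$ refer to the positive semidefinite order on Hermitian matrices. ''Optimal value'' means supremum for (P) and infimum for (D). ''Strictly feasible'' means there is a point satisfying all inequality constraints of (D) strictly. *)

(* Defs.v *)
From HB Require Import structures.
From mathcomp Require Import all_boot all_order all_algebra.
From mathcomp Require Import spectral sesquilinear complex.
From mathcomp Require Import classical_sets reals ereal.

Set Implicit Arguments.
Unset Strict Implicit.
Unset Printing Implicit Defensive.

Import Order.TTheory GRing.Theory Num.Theory.

Local Open Scope classical_set_scope.
Local Open Scope ring_scope.
Local Open Scope sesquilinear_scope.
Local Open Scope complex_scope.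

(* On [R[i]], [x <= y] and [x < y] entail that [y - x] is real, and the norm
   [`|x|] is a real element of [R[i]]. *)

Definition psdmx (R : realType) (n : nat) (M : 'M[R[i]]_n) : Prop :=
  M \is hermsymmx /\ forall x : 'cV[R[i]]_n, 0 <= (x^t* *m M *m x) 0 0.

Definition pdmx (R : realType) (n : nat) (M : 'M[R[i]]_n) : Prop :=
  M \is hermsymmx /\
  forall x : 'cV[R[i]]_n, x != 0 -> 0 < (x^t* *m M *m x) 0 0.

Definition loewner_le (R : realType) (n : nat) (M N : 'M[R[i]]_n) : Prop :=
  psdmx (N - M).

Definition loewner_lt (R : realType) (n : nat) (M N : 'M[R[i]]_n) : Prop :=
  pdmx (N - M).

(* The set is finite, so this supremum is a maximum when [0 < n]; it is [0]
   when [n = 0]. *)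
Definition spectral_radius (R : realType) (n : nat) (A : 'M[R[i]]_n) : R :=
  sup [set complex.Re `|a| | a in [set a : R[i] | eigenvalue A a]].

Definition output_gram (R : realType) (n m p : nat)
    (C : 'M[R[i]]_(p, n)) (D : 'M[R[i]]_(p, m)) : 'M[R[i]]_(n + m) :=
  block_mx (C^t* *m C) (C^t* *m D) (D^t* *m C) (D^t* *m D).

Definition primal_var (R : realType) (n m : nat)
    (X : 'M[R[i]]_n) (Q : 'M[R[i]]_(n, m)) (W : 'M[R[i]]_m) :
    'M[R[i]]_(n + m) :=
  block_mx X Q (Q^t*) W.

Definition primal_feasible (R : realType) (n m k : nat)
    (A : 'M[R[i]]_n) (B : 'M[R[i]]_(n, m))
    (X : 'M[R[i]]_n) (Q : 'M[R[i]]_(n, m)) (W : 'M[R[i]]_m) : Prop :=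
  [/\ X = row_mx A B *m primal_var X Q W *m col_mx (A^t*) (B^t*),
      \tr W <= 1,
      \sum_i \sum_j `|W i j| <= k%:R
    & loewner_le 0 (primal_var X Q W)].

(* The trace is real at feasible points, being that of a product of two
   Hermitian matrices, so taking its real part loses nothing. *)
Definition primal_objective (R : realType) (n m p : nat)
    (C : 'M[R[i]]_(p, n)) (D : 'M[R[i]]_(p, m))
    (X : 'M[R[i]]_n) (Q : 'M[R[i]]_(n, m)) (W : 'M[R[i]]_m) : R :=
  complex.Re (\tr (output_gram C D *m primal_var X Q W)).

Definition primal_value (R : realType) (n m p k : nat)
    (A : 'M[R[i]]_n) (B : 'M[R[i]]_(n, m))
    (C : 'M[R[i]]_(p, n)) (D : 'M[R[i]]_(p, m)) : \bar R :=
  ereal_sup [set v : \bar R | exists X Q W,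
    primal_feasible k A B X Q W /\ v = (primal_objective C D X Q W)%:E].

Definition dual_lmi (R : realType) (n m p : nat)
    (A : 'M[R[i]]_n) (B : 'M[R[i]]_(n, m))
    (C : 'M[R[i]]_(p, n)) (D : 'M[R[i]]_(p, m))
    (P : 'M[R[i]]_n) (Y : 'M[R[i]]_m) (lambda : R) : 'M[R[i]]_(n + m) :=
  block_mx (A^t* *m P *m A - P) (A^t* *m P *m B)
           (B^t* *m P *m A) (B^t* *m P *m B - (lambda%:C)%:M - Y)
  + output_gram C D.

Definition dual_feasible (R : realType) (n m p : nat)
    (A : 'M[R[i]]_n) (B : 'M[R[i]]_(n, m))
    (C : 'M[R[i]]_(p, n)) (D : 'M[R[i]]_(p, m))
    (P : 'M[R[i]]_n) (Y : 'M[R[i]]_m) (lambda t : R) : Prop :=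
  (P \is hermsymmx /\ Y \is hermsymmx) /\
  [/\ 0 <= lambda, 0 <= t,
      loewner_le (dual_lmi A B C D P Y lambda) 0
    & forall i j, `|Y i j| <= t%:C].

Definition dual_strictly_feasible (R : realType) (n m p : nat)
    (A : 'M[R[i]]_n) (B : 'M[R[i]]_(n, m))
    (C : 'M[R[i]]_(p, n)) (D : 'M[R[i]]_(p, m)) : Prop :=
  exists (P : 'M[R[i]]_n) (Y : 'M[R[i]]_m) (lambda t : R),
  (P \is hermsymmx /\ Y \is hermsymmx) /\
  [/\ 0 < lambda, 0 < t,
      loewner_lt (dual_lmi A B C D P Y lambda) 0
    & forall i j, `|Y i j| < t%:C].

Definition dual_value (R : realType) (n m p k : nat)
    (A : 'M[R[i]]_n) (B : 'M[R[i]]_(n, m))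
    (C : 'M[R[i]]_(p, n)) (D : 'M[R[i]]_(p, m)) : \bar R :=
  ereal_inf [set v : \bar R | exists P Y lambda t,
    dual_feasible A B C D P Y lambda t /\ v = (lambda + k%:R * t)%:E].

(* Main.v *)
Require Import Defs.
From HB Require Import structures.
From mathcomp Require Import all_boot all_order all_algebra.
From mathcomp Require Import spectral sesquilinear complex.
From mathcomp Require Import classical_sets reals ereal.
From mathcomp Require Import ring lra.

(** Replacing the output Gram matrix by an arbitrary matrix [M], the dual
    constraints cut out a convex cone, so the dual value [q M] is a sublinear
    function of [M]. It is finite everywhere, because a stable [A] makes the
    dual strictly feasible for every [M]. Hahn-Banach at the Gram matrix [G]
    yields [Z] with [Re tr(Z M) <= q M] for all [M] and equality at [M = G].
    Evaluating the inequality at well-chosen [M] says exactly that [Z] is primal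
    feasible, and the equality says that its objective is the dual value.

    Strict feasibility needs a Hermitian solution [P] of the Stein equation
    [A^* P A - P = Q]. It exists because [P |-> A^* P A - P] is injective when
    every eigenvalue of [A] has modulus less than [1]. *)

Set Implicit Arguments.
Unset Strict Implicit.
Unset Printing Implicit Defensive.

Import Order.TTheory GRing.Theory Num.Theory.

Local Open Scope classical_set_scope.
Local Open Scope ring_scope.
Local Open Scope sesquilinear_scope.
Local Open Scope complex_scope.

(** * Real parts and moduli of complex numbers *)

Section ComplexParts.
Variable R : realType.
Implicit Types (a : R) (x y : R[i]).

Lemma cReD x y : complex.Re (x + y) = complex.Re x + complex.Re y.
Proof. by case: x; case: y. Qed.

Lemma cReN x : complex.Re (- x) = - complex.Re x.
Proof. by case: x. Qed.

Lemma cReMr a x : complex.Re (a%:C * x) = a * complex.Re x.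
Proof. by case: x => u v /=; rewrite mul0r subr0. Qed.

Lemma cRe_conj x : complex.Re (Num.conj x) = complex.Re x.
Proof. by case: x. Qed.

Lemma cRe_sum (I : Type) (r : seq I) (P : pred I) (F : I -> R[i]) :
  complex.Re (\sum_(i <- r | P i) F i) = \sum_(i <- r | P i) complex.Re (F i).
Proof. exact: (big_morph _ cReD). Qed.

Lemma cRe_le x y : x <= y -> complex.Re x <= complex.Re y.
Proof. by rewrite lecE => /andP[]. Qed.

Lemma cRe_le_norm x : complex.Re x <= complex.Re `|x|.
Proof.
by have /cRe_le := normc_ge_Re x; apply: le_trans; rewrite /= ler_norm.
Qed.

Lemma norm_cRe x : `|x| = (complex.Re `|x|)%:C.
Proof. by rewrite normc_def. Qed.

Lemma conj_real x : Num.conj x = x -> x = (complex.Re x)%:C.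
Proof.
case: x => u v [] /eqP.
by rewrite eq_sym -addr_eq0 -mulr2n mulrn_eq0 /= => /eqP ->.
Qed.

End ComplexParts.

(** * Sublinear functions and a finite-dimensional Hahn-Banach theorem *)

Section HahnBanach.
Variables (R : realType) (V : lmodType R[i]).
Implicit Types (p : V -> R) (x y v : V).

Definition sublinear p :=
  (forall x y, p (x + y) <= p x + p y) /\
  (forall (a : R) x, 0 < a -> p (a%:C *: x) = a * p x).

Lemma sublinear0 p : sublinear p -> p 0 = 0.
Proof.
by move=> [_ pZ]; have := pZ 2%:R 0 ltac:(by []); rewrite scaler0 => ?; lra.
Qed.

Lemma sublinear_opp p x : sublinear p -> 0 <= p x + p (- x).
Proof. by move=> sp; rewrite -(sublinear0 sp) -(subrr x) sp.1. Qed.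

(* Together with [f <= p] the last bound makes [f] linear along [v], with
   [f v = p v]. Applied to a spanning family, this replaces Zorn's lemma. *)
Lemma sublinear_flatten p v : sublinear p ->
  exists f, [/\ sublinear f, forall x, f x <= p x & f (- v) <= - p v].
Proof.
move=> sp; have [pD pZ] := sp.
(* The infimum of [S x] is the greatest sublinear function below [p] whose value at [- v] is at most
   [- p v]. *)
pose S x : set R :=
  [set r | exists2 s : R, 0 <= s & r = p (x + s%:C *: v) - s * p v].
have pZ0 s x : 0 <= s -> p (s%:C *: x) = s * p x.
  rewrite le_eqVlt => /predU1P[<-|]; last exact: pZ.
  by rewrite scale0r mul0r sublinear0.
have Slb x : lbound (S x) (- p (- x)).
  move=> _ [s s0 ->]; have := pD (x + s%:C *: v) (- x).
  by rewrite addrAC subrr add0r pZ0 // => ?; lra.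
have Sinf x : has_inf (S x).
  split; last by exists (- p (- x)); exact: Slb.
  by exists (p (x + 0%:C *: v) - 0 * p v); exists 0.
have infS x s : 0 <= s -> inf (S x) <= p (x + s%:C *: v) - s * p v.
  by move=> s0; apply: ge_inf; [case: (Sinf x)|exists s].
exists (fun x => inf (S x)); split; first split.
- move=> x y; rewrite -lerBlDr; apply: lb_le_inf; first by case: (Sinf x).
  move=> _ [s s0 ->]; rewrite lerBlDr -lerBlDl.
  apply: lb_le_inf; first by case: (Sinf y).
  move=> _ [t t0 ->]; rewrite lerBlDl.
  apply: le_trans (infS _ (s + t) (addr_ge0 s0 t0)) _.
  have -> : x + y + (s + t)%:C *: v = (x + s%:C *: v) + (y + t%:C *: v).
    by rewrite rmorphD scalerDl addrACA.
  by have := pD (x + s%:C *: v) (y + t%:C *: v); lra.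
(* One inequality for all [a > 0] suffices: applied to [a^-1] it gives the converse. *)
- have half a x : 0 < a -> a * inf (S x) <= inf (S (a%:C *: x)).
    move=> a0; apply: lb_le_inf; first by case: (Sinf (a%:C *: x)).
    move=> _ [s s0 ->].
    have -> : a%:C *: x + s%:C *: v = a%:C *: (x + (s / a)%:C *: v).
      by rewrite scalerDr scalerA -rmorphM mulrC divfK ?gt_eqF.
    rewrite pZ // -[s in s * p v](@divfK _ a) ?gt_eqF //.
    rewrite [s / a * a]mulrC -mulrA -mulrBr ler_pM2l //.
    by apply: infS; rewrite divr_ge0 // ltW.
  move=> a x a0; apply/eqP; rewrite eq_le half // andbT.
  have := half a^-1 (a%:C *: x); rewrite invr_gt0 => /(_ a0).
  rewrite scalerA -rmorphM mulVf ?gt_eqF // scale1r.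
  by rewrite -(ler_pM2l a0) mulrA divff ?gt_eqF // mul1r.
- by move=> x; have := infS x 0 (lexx _); rewrite scale0r addr0 mul0r subr0.
- have := infS (- v) 1 ler01.
  by rewrite scale1r addNr sublinear0 // mul1r sub0r.
Qed.

(** Later flattenings only decrease the function, so the inequality [f v + f (- v) <= 0] obtained
    for an earlier [v] survives them. *)
Lemma sublinear_flatten_seq (s : seq V) p : sublinear p ->
  exists f, [/\ sublinear f, forall x, f x <= p x
    & forall v, v \in s -> f v + f (- v) <= 0].
Proof.
elim: s p => [|v s IHs] p sp; first by exists p.
have [f1 [sf1 f1p f1v]] := sublinear_flatten v sp.
have [f [sf ff1 fs]] := IHs f1 sf1.
exists f; split=> // [x|w]; first exact: le_trans (f1p x).
rewrite inE => /predU1P[-> | /fs //].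
by have := ff1 v; have := ff1 (- v); have := f1p v; lra.
Qed.

End HahnBanach.

Section HahnBanachMatrix.
Variables (R : realType) (N : nat).

(** Flattening first at [G] secures the value there. Flattening along a real basis of the matrices
    then leaves a real-linear function, which the trace pairing represents. *)
Lemma hahn_banach_mx (p : 'M[R[i]]_N -> R) (G : 'M[R[i]]_N) : sublinear p ->
  exists Z : 'M[R[i]]_N, (forall M, complex.Re (\tr (Z *m M)) <= p M) /\
    complex.Re (\tr (Z *m G)) = p G.
Proof.
move=> sp.
have [f1 [sf1 f1p f1G]] := sublinear_flatten G sp.
pose e (u : 'I_N * 'I_N * bool) : 'M[R[i]]_N :=
  (if u.2 then 'i else 1) *: delta_mx u.1.1 u.1.2.
have [f [sf ff1 fe]] :=
  sublinear_flatten_seq [seq e u | u <- enum (_ : predArgType)] sf1.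
have [fD fZ] := sf.
have f0 := sublinear0 sf.
(* [L x] says that [f] is linear on the real line through [x]. Such [x] are closed under sums and
   real multiples. *)
pose L x := f x + f (- x) <= 0.
have LN x : L x -> f (- x) = - f x.
  by move=> Lx; have := sublinear_opp x sf; move: Lx; rewrite /L; lra.
have LD x y : L x -> L y -> L (x + y) /\ f (x + y) = f x + f y.
  move=> Lx Ly; have := fD x y; have := fD (- x) (- y).
  rewrite -opprD; have := sublinear_opp (x + y) sf.
  rewrite /L (LN x) // (LN y) //.
  by split; lra.
have LZ a x : L x -> L (a%:C *: x) /\ f (a%:C *: x) = a * f x.
  move=> Lx; case: (ltgtP a 0) => a0; last first.
  - by rewrite a0 /L scale0r oppr0 f0 mul0r; split; lra.
  - by rewrite /L -scalerN !fZ // LN //; split; lra.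
  - have -> : a%:C *: x = (- a)%:C *: (- x).
      by rewrite rmorphN scalerN scaleNr opprK.
    by rewrite /L -scalerN opprK !fZ ?oppr_gt0 // LN //; split; lra.
have Lsum (I : Type) (r : seq I) (F : I -> 'M[R[i]]_N) : (forall i, L (F i)) ->
    L (\sum_(i <- r) F i) /\ f (\sum_(i <- r) F i) = \sum_(i <- r) f (F i).
  move=> LF; elim: r => [|i r [IH1 IH2]].
    by rewrite !big_nil /L oppr0 f0; split; lra.
  by rewrite !big_cons; have [? ->] := LD _ _ (LF i) IH1; rewrite IH2.
have Le u : L (e u) by apply: fe; apply: map_f; rewrite mem_enum.
(* The indices are swapped because of the trace, and the minus sign comes from
   [Re ((a - ib) (c + id)) = a c + b d]. *)
pose Z := \matrix_(j, i) (f (e (i, j, false)) -i* f (e (i, j, true))).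
have fZ' M : f M = complex.Re (\tr (Z *m M)).
  pose c i j := (complex.Re (M i j))%:C *: e (i, j, false)
              + (complex.Im (M i j))%:C *: e (i, j, true).
  have cP i j : L (c i j) /\ f (c i j) = complex.Re (Z j i * M i j).
    have [L1 f1E] := LZ (complex.Re (M i j)) _ (Le (i, j, false)).
    have [L2 f2E] := LZ (complex.Im (M i j)) _ (Le (i, j, true)).
    have [? ->] := LD _ _ L1 L2; split=> //; rewrite f1E f2E mxE.
    by case: (M i j) => a b /=; ring.
  have EM : M = \sum_i \sum_j c i j.
    rewrite [LHS]matrix_sum_delta; apply: eq_bigr => i _; apply: eq_bigr => j _.
    rewrite /c /e /= !scalerA -scalerDl mulr1; congr (_ *: _).
    by rewrite [LHS]complexE mulrC.
  rewrite {1}EM (Lsum _ _ _ _).2; last first.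
    by move=> i; apply: (Lsum _ _ _ _).1 => j; case: (cP i j).
  rewrite /mxtrace cRe_sum [RHS](eq_bigr (fun j => \sum_i
    complex.Re (Z j i * M i j))); last by move=> j _; rewrite mxE cRe_sum.
  rewrite exchange_big; apply: eq_bigr => i _.
  rewrite (Lsum _ _ _ _).2; last by move=> j; case: (cP i j).
  by apply: eq_bigr => j _; case: (cP i j).
exists Z; split=> [M|]; first by rewrite -fZ'; apply: le_trans (f1p M).
(* The lower bound on [f G] comes from [f (- G) <= f1 (- G) <= - p G]. *)
rewrite -fZ'; apply/eqP; rewrite eq_le (le_trans (ff1 G)) //= ?f1p //.
by have := sublinear_opp G sf; have := ff1 (- G); lra.
Qed.

End HahnBanachMatrix.

(** * Conjugate transposes and Hermitian matrices *)

Section Adjoint.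
Variable C : numClosedFieldType.

Lemma ctrmxM m n p (A : 'M[C]_(m, n)) (B : 'M[C]_(n, p)) :
  (A *m B)^t* = B^t* *m A^t*.
Proof. by rewrite trmx_mul map_mxM. Qed.

Lemma ctrmxD m n (A B : 'M[C]_(m, n)) : (A + B)^t* = A^t* + B^t*.
Proof. by rewrite linearD map_mxD. Qed.

Lemma ctrmxN m n (A : 'M[C]_(m, n)) : (- A)^t* = - A^t*.
Proof. by rewrite linearN map_mxN. Qed.

Lemma ctrmxB m n (A B : 'M[C]_(m, n)) : (A - B)^t* = A^t* - B^t*.
Proof. by rewrite ctrmxD ctrmxN. Qed.

Lemma ctrmxZ m n (a : C) (A : 'M[C]_(m, n)) : (a *: A)^t* = Num.conj a *: A^t*.
Proof. by rewrite linearZ map_mxZ. Qed.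

Lemma ctrmx_block m1 m2 n1 n2 (A : 'M[C]_(m1, n1)) (B : 'M[C]_(m1, n2))
  (D : 'M[C]_(m2, n1)) (E : 'M[C]_(m2, n2)) :
  (block_mx A B D E)^t* = block_mx (A^t*) (D^t*) (B^t*) (E^t*).
Proof. by rewrite tr_block_mx map_block_mx. Qed.

Lemma mxtrace_ctrmx n (A : 'M[C]_n) : \tr (A^t*) = Num.conj (\tr A).
Proof. by rewrite /mxtrace rmorph_sum; apply: eq_bigr => i _; rewrite !mxE. Qed.

Lemma hermsymmxP n (A : 'M[C]_n) : reflect (A^t* = A) (A \is hermsymmx).
Proof.
by apply: (iffP (is_hermitianmxP _ _ _)); rewrite expr0 scale1r => /esym.
Qed.

Lemma hermsymm0 n : (0 : 'M[C]_n) \is hermsymmx.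
Proof. by apply/hermsymmxP; rewrite trmx0 map_mx0. Qed.

Lemma hermsymmD n (M1 M2 : 'M[C]_n) :
  M1 \is hermsymmx -> M2 \is hermsymmx -> M1 + M2 \is hermsymmx.
Proof.
by move=> /hermsymmxP h1 /hermsymmxP h2; apply/hermsymmxP; rewrite ctrmxD h1 h2.
Qed.

Lemma hermsymmN n (M : 'M[C]_n) : M \is hermsymmx -> - M \is hermsymmx.
Proof. by move=> /hermsymmxP h; apply/hermsymmxP; rewrite ctrmxN h. Qed.

End Adjoint.

Lemma hermsymmZ (R : realType) n (a : R) (M : 'M[R[i]]_n) :
  M \is hermsymmx -> a%:C *: M \is hermsymmx.
Proof.
move=> /hermsymmxP h; apply/hermsymmxP; rewrite ctrmxZ h; congr (_ *: _).
exact: conjc_real.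
Qed.

(** * The Stein equation for a stable matrix *)

Section Stein.
Variable R : realType.
Local Notation C := R[i].

Lemma spectral_radius_lt1 n (A : 'M[C]_n) (a : C) :
  spectral_radius A < 1 -> eigenvalue A a -> `|a| < 1.
Proof.
move=> rA Aa; suff: complex.Re `|a| <= spectral_radius A.
  by move=> le_a; rewrite norm_cRe ltcR; apply: le_lt_trans rA.
apply: ub_le_sup; last by exists a.
have [rs rsE] := closed_field_poly_normal (char_poly A).
(* The supremum dominates its set only once the set is known to be bounded; the sum of the moduli of
   all roots of the characteristic polynomial is a bound. *)
exists (\sum_(z <- rs) complex.Re `|z|) => _ [z /= Az <-].
have z_rs : z \in rs.
  move: Az; rewrite eigenvalue_root_char rsE (monicP (char_poly_monic A)).
  by rewrite scale1r root_prod_XsubC.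
rewrite (big_rem z) //= lerDl; apply: sumr_ge0 => y _.
by rewrite -ler0c -norm_cRe.
Qed.

(* If [X] solves [A^* X A = X], so does [X (A - a)]; hence the factors of the
   characteristic polynomial of [A] can be cancelled one at a time from the
   Cayley-Hamilton identity. *)
Lemma stein_injective n (A P : 'M[C]_n) :
  (forall a, eigenvalue A a -> `|a| < 1) -> A^t* *m P *m A = P -> P = 0.
Proof.
case: n A P => [|n] A P ltA; first by rewrite [P]flatmx0.
have key (s : seq C) : all (fun a => `|a| < 1) s -> forall X : 'M_n.+1,
    A^t* *m X *m A = X -> X *m (\prod_(a <- s) (A - a%:M)) = 0 -> X = 0.
  elim: s => [_ X _|a s IHs /= /andP[lt_a lts] X AX].
    by rewrite big_nil mulmx1.
  rewrite big_cons -mulmxE mulmxA => /(IHs lts) XA0.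
  have {}XA0 : X *m A = a *: X.
    apply/eqP; rewrite -subr_eq0 -mul_mx_scalar -mulmxBr XA0 //.
    rewrite [X *m _]mulmxBr mul_mx_scalar mulmxBr mulmxBl mulmxA AX.
    by rewrite -scalemxAr -scalemxAl AX.
  (* Since [X A = a X], the equation reads [a A^* X = X]. By its adjoint, a nonzero [v] in the row
     space of [X^*] is a left eigenvector of [A] for the inverse of the conjugate of [a]; that
     inverse and [a] cannot both have modulus below 1. *)
  have {AX} AX : X^t* = Num.conj a *: (X^t* *m A).
    by rewrite -{1}AX -mulmxA XA0 -scalemxAr ctrmxZ ctrmxM trmxCK.
  suff X0 : X^t* = 0 by rewrite -[X]trmxCK X0 trmx0 map_mx0.
  apply/eqP/rowV0P => v /submxP[D vE]; apply/eqP/negP => /negP v0.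
  have {}vE : v = Num.conj a *: (v *m A) by rewrite vE {1}AX -scalemxAr mulmxA.
  have a0 : Num.conj a != 0.
    by apply: contra_neq v0 => a0; rewrite vE a0 scale0r.
  have: `|(Num.conj a)^-1| < 1.
    apply: ltA; apply/eigenvalueP; exists v => //.
    by rewrite {2}vE scalerA mulVf // scale1r.
  have na0 : 0 < `|a| by rewrite normr_gt0 -conjC_eq0.
  rewrite normfV norm_conjC => lt1.
  have : 1 < `|a|^-1 by rewrite invf_gt1.
  by move=> /lt_trans/(_ lt1); rewrite ltxx.
move=> AP; have [rs rsE] := closed_field_poly_normal (char_poly A).
rewrite (monicP (char_poly_monic A)) scale1r in rsE.
apply: (key rs) => //.
  apply/allP => z z_rs; apply: ltA.
  by rewrite eigenvalue_root_char rsE root_prod_XsubC.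
have := Cayley_Hamilton A; rewrite rsE rmorph_prod => CH.
rewrite -[RHS](mulmx0 _ P) -CH; congr (_ *m _); apply: eq_bigr => a _.
by rewrite rmorphB /= horner_mx_X horner_mx_C.
Qed.

(** An injective endomorphism of a finite-dimensional space is invertible. The adjoint of a solution
    is again a solution, so averaging the two gives a Hermitian one. *)
Lemma stein_solvable n (A Q : 'M[C]_n) :
  (forall a, eigenvalue A a -> `|a| < 1) -> Q \is hermsymmx ->
  exists2 P : 'M[C]_n, P \is hermsymmx & A^t* *m P *m A - P = Q.
Proof.
move=> ltA /hermsymmxP QH.
pose L := lin_mx (mulmxr A \o mulmx (A^t*)) - 1%:M.
have LE X : mxvec X *m L = mxvec (A^t* *m X *m A - X).
  by rewrite mulmxBr mulmx1 mul_vec_lin linearB.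
have Lunit : L \in unitmx.
  rewrite -row_free_unit; apply: inj_row_free => v.
  rewrite -[v]vec_mxK LE => /eqP; rewrite mxvec_eq0 subr_eq0.
  by move=> /eqP/stein_injective; move=> ->; rewrite ?linear0.
have [X XE] : exists X, A^t* *m X *m A - X = Q.
  exists (vec_mx (mxvec Q *m invmx L)).
  by apply: (can_inj mxvecK); rewrite -LE vec_mxK mulmxKV.
exists (2^-1 *: (X + X^t*)).
  by apply/hermsymmxP; rewrite ctrmxZ ctrmxD trmxCK addrC fmorphV rmorph_nat.
rewrite -scalemxAr -scalemxAl -scalerBr mulmxDr mulmxDl opprD addrACA XE.
have -> : A^t* *m X^t* *m A - X^t* = Q.
  by rewrite -QH -XE ctrmxB !ctrmxM trmxCK mulmxA.
by rewrite -mulr2n -[Q *+ 2]scaler_nat scalerA mulVf ?scale1r // pnatr_eq0.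
Qed.

End Stein.

(** * Quadratic forms and semidefiniteness *)

Section QuadraticForm.
Variable R : realType.
Local Notation C := R[i].

(** Taking the real part gives a real-valued form for every complex [M], which sees only the
    Hermitian part of [M]. *)
Definition qform n (M : 'M[C]_n) (x : 'cV[C]_n) : R :=
  complex.Re ((x^t* *m M *m x) 0 0).

Definition sqnorm n (x : 'cV[C]_n) : R := complex.Re ((x^t* *m x) 0 0).

Lemma qformD n (M N : 'M[C]_n) x : qform (M + N) x = qform M x + qform N x.
Proof. by rewrite /qform mulmxDr mulmxDl mxE cReD. Qed.

Lemma qformN n (M : 'M[C]_n) x : qform (- M) x = - qform M x.
Proof. by rewrite /qform mulmxN mulNmx mxE cReN. Qed.

Lemma qformZ n (a : R) (M : 'M[C]_n) x : qform (a%:C *: M) x = a * qform M x.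
Proof. by rewrite /qform -scalemxAr -scalemxAl mxE cReMr. Qed.

Lemma qform0 n (x : 'cV[C]_n) : qform 0 x = 0.
Proof. by rewrite /qform mulmx0 mul0mx mxE. Qed.

Lemma qform_ctrmx n (M : 'M[C]_n) x : qform (M^t*) x = qform M x.
Proof.
rewrite /qform -[RHS]cRe_conj.
have -> : Num.conj ((x^t* *m M *m x) 0 0) = (x^t* *m M *m x)^t* 0 0.
  by rewrite !mxE.
by rewrite !ctrmxM trmxCK mulmxA.
Qed.

Lemma qform_gram n k (r : 'M[C]_(k, n)) x :
  qform (r^t* *m r) x = sqnorm (r *m x).
Proof. by rewrite /qform /sqnorm ctrmxM !mulmxA. Qed.

Lemma qform_tr n (M : 'M[C]_n) x :
  qform M x = complex.Re (\tr (M *m (x *m x^t*))).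
Proof. by rewrite mulmxA mxtrace_mulC mulmxA trace_mx11. Qed.

Lemma hermsymm_qformE n (M : 'M[C]_n) x : M \is hermsymmx ->
  (x^t* *m M *m x) 0 0 = (qform M x)%:C.
Proof.
move=> /hermsymmxP MH.
have: Num.conj ((x^t* *m M *m x) 0 0) = (x^t* *m M *m x) 0 0.
  transitivity (((x^t* *m M *m x)^t*) 0 0); first by rewrite !mxE.
  by rewrite !ctrmxM trmxCK MH mulmxA.
exact: conj_real.
Qed.

Lemma psdmxP n (M : 'M[C]_n) :
  psdmx M <-> M \is hermsymmx /\ forall x, 0 <= qform M x.
Proof.
split=> -[MH Mx]; split=> // x.
  by have := Mx x; rewrite hermsymm_qformE // ler0c.
by rewrite hermsymm_qformE // ler0c.
Qed.

Lemma pdmxP n (M : 'M[C]_n) :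
  pdmx M <-> M \is hermsymmx /\ forall x, x != 0 -> 0 < qform M x.
Proof.
by split=> -[MH Mx]; split=> // x /Mx; rewrite hermsymm_qformE // ltcR.
Qed.

Lemma sqnormE n (x : 'cV[C]_n) : sqnorm x = \sum_i complex.Re `|x i 0| ^+ 2.
Proof.
rewrite /sqnorm mxE cRe_sum; apply: eq_bigr => i _.
by rewrite !mxE mulrC -normCK norm_cRe -rmorphXn.
Qed.

Lemma sqnorm_ge0 n (x : 'cV[C]_n) : 0 <= sqnorm x.
Proof. by rewrite sqnormE sumr_ge0 // => i _; rewrite sqr_ge0. Qed.

Lemma sqnorm_gt0 n (x : 'cV[C]_n) : x != 0 -> 0 < sqnorm x.
Proof.
move=> x0; rewrite lt_def sqnorm_ge0 andbT; apply: contra_neq x0.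
rewrite sqnormE => /eqP.
rewrite psumr_eq0 => [/allP x0|i _]; last exact: sqr_ge0.
apply/colP => i; have := x0 i (mem_index_enum _).
rewrite sqrf_eq0 mxE => /eqP xi.
by apply/eqP; rewrite -normr_eq0 norm_cRe xi.
Qed.

(** A crude bound on the numerical range, from [2 |x_i| |x_j| <= |x_i|^2 + |x_j|^2]; it serves to
    choose [lambda]. *)
Lemma qform_le_sqnorm n (M : 'M[C]_n) x :
  qform M x <= (\sum_i \sum_j complex.Re `|M i j|) * sqnorm x.
Proof.
have le_sq i : complex.Re `|x i 0| ^+ 2 <= sqnorm x.
  rewrite sqnormE (bigD1 i) //= lerDl.
  by apply: sumr_ge0 => j _; rewrite sqr_ge0.
rewrite /qform -mulmxA mxE cRe_sum mulr_suml; apply: ler_sum => i _.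
rewrite !mxE mulr_sumr cRe_sum mulr_suml; apply: ler_sum => j _.
apply: le_trans (cRe_le_norm _) _; rewrite !normrM norm_conjC.
rewrite (norm_cRe (x i 0)) (norm_cRe (x j 0)) (norm_cRe (M i j)) -!rmorphM.
have : 0 <= complex.Re `|M i j| by rewrite -ler0c -norm_cRe.
move: (le_sq i) (le_sq j).
move: (complex.Re `|x i 0|) (complex.Re `|x j 0|) (complex.Re `|M i j|).
move=> a b c /= a2 b2 c0; rewrite mulrCA ler_wpM2l //.
by have := sqr_ge0 (a - b); nra.
Qed.

(** In an orthonormal eigenbasis of [Z], the trace is a sum of eigenvalues of [Z] times values of
    [qform M] at eigenvectors. *)
Lemma psdmx_trace_le0 n (Z M : 'M[C]_n) :
  psdmx Z -> (forall x, qform M x <= 0) -> complex.Re (\tr (Z *m M)) <= 0.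
Proof.
move=> /psdmxP[ZH Z0] M0; have /orthomx_spectralP := hermitian_normalmx ZH.
move: (spectralmx Z) (spectral_diag Z) (spectral_unitarymx Z) => U d Uu.
rewrite invmx_unitary // => ZE.
have diagE (N : 'M[C]_n) i :
    complex.Re ((U *m N *m U^t*) i i) = qform N ((row i U)^t*).
  rewrite /qform trmxCK -!row_mul !mxE; congr complex.Re.
  by apply: eq_bigr => j _; rewrite !mxE.
have UZ : U *m Z *m U^t* = diag_mx d.
  by rewrite {1}ZE !mulmxA (unitarymxP Uu) mul1mx mulmxtVK.
have d0 i : 0 <= complex.Re (d 0 i).
  by have := Z0 ((row i U)^t*); rewrite -diagE UZ !mxE eqxx mulr1n.
have dR i : d 0 i = (complex.Re (d 0 i))%:C.
  have : (diag_mx d)^t* = diag_mx d.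
    by rewrite -UZ !ctrmxM trmxCK (hermsymmxP _ ZH) mulmxA.
  by move=> /matrixP/(_ i i); rewrite !mxE eqxx !mulr1n => /conj_real.
have -> : \tr (Z *m M) = \tr (diag_mx d *m (U *m M *m U^t*)).
  by rewrite {1}ZE -!mulmxA [LHS]mxtrace_mulC -!mulmxA.
rewrite /mxtrace cRe_sum; apply: sumr_le0 => i _.
by rewrite mul_diag_mx mxE dR cReMr diagE mulr_ge0_le0.
Qed.

End QuadraticForm.

(** * The linear matrix inequality of the dual *)

Section LMI.
Variables (R : realType) (n m : nat).
Local Notation C := R[i].
Variables (A : 'M[C]_n) (B : 'M[C]_(n, m)).
Implicit Types (P X : 'M[C]_n) (Y W : 'M[C]_m) (M Z : 'M[C]_(n + m)).

(** The part of [dual_lmi] that is linear in the dual variables; the Gram matrix is split off so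
    that any [M] can take its place. *)
Definition lmi P Y (l : R) : 'M[C]_(n + m) :=
  block_mx (A^t* *m P *m A - P) (A^t* *m P *m B)
           (B^t* *m P *m A) (B^t* *m P *m B - (l%:C)%:M - Y).

Lemma lmiE P Y (l : R) :
  lmi P Y l =
  (row_mx A B)^t* *m P *m row_mx A B - block_mx P 0 0 ((l%:C)%:M + Y).
Proof.
rewrite tr_row_mx map_col_mx mul_col_mx mul_col_row opp_block_mx add_block_mx.
by rewrite /lmi !oppr0 !addr0 opprD addrA.
Qed.

Lemma lmiD P1 Y1 (l1 : R) P2 Y2 (l2 : R) :
  lmi (P1 + P2) (Y1 + Y2) (l1 + l2) = lmi P1 Y1 l1 + lmi P2 Y2 l2.
Proof.
rewrite !lmiE mulmxDr mulmxDl addrACA -opprD add_block_mx !addr0.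
by rewrite rmorphD raddfD [X in block_mx _ _ _ X]addrACA.
Qed.

Lemma lmiZ (a : R) P Y (l : R) :
  lmi (a%:C *: P) (a%:C *: Y) (a * l) = a%:C *: lmi P Y l.
Proof.
rewrite !lmiE scalerBr -scalemxAr -scalemxAl scale_block_mx !scaler0 scalerDr.
by rewrite rmorphM scale_scalar_mx.
Qed.

Lemma lmi_hermsymm P Y l : P \is hermsymmx -> Y \is hermsymmx ->
  lmi P Y l \is hermsymmx.
Proof.
move=> /hermsymmxP PH /hermsymmxP YH; apply/hermsymmxP.
rewrite lmiE ctrmxB !ctrmxM trmxCK PH mulmxA ctrmx_block PH ctrmxD YH.
rewrite !trmx0 !map_mx0.
have lR : Num.conj l%:C = l%:C := conjc_real l.
by rewrite tr_scalar_mx map_scalar_mx /= lR.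
Qed.

(** This computes the adjoint of [lmi]: [P] is paired with the residual of the primal equation, [l]
    with the trace of the [W] block, and [Y] with that block. *)
Lemma mxtrace_lmi Z P Y (l : R) :
  \tr (Z *m lmi P Y l) =
  \tr (P *m (row_mx A B *m Z *m col_mx (A^t*) (B^t*) - ulsubmx Z))
  - l%:C * \tr (drsubmx Z) - \tr (drsubmx Z *m Y).
Proof.
rewrite lmiE mulmxBr [LHS]linearB /= -map_col_mx -tr_row_mx.
rewrite mulmxBr [\tr (_ - _ *m ulsubmx Z)]linearB /=.
rewrite mulmxA mxtrace_mulC !mulmxA [X in X - _ = _]mxtrace_mulC !mulmxA.
rewrite -{2}[Z]submxK mulmx_block mxtrace_block !mulmx0 addr0 add0r mulmxDr.
rewrite mul_mx_scalar [\tr (_ + _)]linearD /= linearZ /=.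
by rewrite [\tr (P *m _)]mxtrace_mulC opprD opprD !addrA.
Qed.

(** The Stein equation makes the upper left block of [lmi P 0 l + M] equal to [-I]; a large [l] then
    makes the Schur complement negative. *)
Lemma lmi_neg_exists M : (forall a, eigenvalue A a -> `|a| < 1) ->
  M \is hermsymmx ->
  exists P (l : R), [/\ P \is hermsymmx, 0 < l &
    forall x, x != 0 -> qform (lmi P 0 l + M) x < 0].
Proof.
move=> ltA /hermsymmxP MH.
have := MH; rewrite -{1 2}[M]submxK ctrmx_block => /eq_block_mx[ulM _ urM drM].
have [] := @stein_solvable R n A (- ulsubmx M - 1%:M) ltA.
  apply/hermsymmxP; rewrite ctrmxB ctrmxN ulM tr_scalar_mx map_scalar_mx.
  by rewrite rmorph1.
move=> P PH PE; have PH' := hermsymmxP _ PH.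
(* [N] is the off-diagonal block, [S] the Schur complement without its [l] term, and [c] bounds the
   form of [S]. The extra 1 in [c + 1] gives strictness. *)
pose N := A^t* *m P *m B + ursubmx M.
pose S := B^t* *m P *m B + drsubmx M + N^t* *m N.
pose c := \sum_i \sum_j complex.Re `|S i j|.
have c0 : 0 <= c.
  by do 2![apply: sumr_ge0 => ? _]; rewrite -ler0c -norm_cRe.
exists P, (c + 1); split=> //; first by rewrite ltr_wpDl.
move=> x x0.
pose K := S - (c + 1)%:C%:M.
pose r := row_mx (- 1%:M) N.
(* completing the square in the first block variable *)
have -> : lmi P 0 (c + 1) + M = block_mx 0 0 0 K - r^t* *m r.
  have {}PE : A^t* *m P *m A - P + ulsubmx M = - 1%:M.
    by rewrite PE addrAC addNr add0r.
  rewrite -{1}[M]submxK add_block_mx PE.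
  rewrite tr_row_mx map_col_mx mul_col_row opp_block_mx add_block_mx.
  have -> : (- 1%:M : 'M[C]_n)^t* = - 1%:M.
    by rewrite ctrmxN tr_scalar_mx map_scalar_mx rmorph1.
  rewrite !mulNmx !mulmxN !mul1mx mulmx1 !opprK !add0r.
  congr block_mx => //.
  - by rewrite ctrmxD !ctrmxM PH' trmxCK mulmxA urM.
  - by rewrite /K /S subr0 [RHS]addrAC addrK addrAC.
rewrite qformD qformN qform_gram -[x]vsubmxK.
set u := usubmx x; set v := dsubmx x.
have -> : qform (block_mx 0 0 0 K) (col_mx u v) = qform K v.
  rewrite /qform tr_col_mx map_row_mx mul_row_block mul_row_col.
  by rewrite !mulmx0 !addr0 !add0r mul0mx add0r.
have -> : r *m col_mx u v = N *m v - u.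
  by rewrite mul_row_col mulNmx mul1mx addrC.
have qK : qform K v <= - sqnorm v.
  rewrite [qform K v]qformD qformN -[_%:M]scalemx1 qformZ.
  have -> : qform 1%:M v = sqnorm v by rewrite /qform mulmx1.
  by rewrite mulrDl mul1r opprD addrA gerDr subr_le0 qform_le_sqnorm.
(* If [v = 0], strictness comes from the square, which is then that of [- u]; otherwise it comes
   from [K]. *)
have [v0|v_neq0] := eqVneq v 0.
  have u_neq0 : - u != 0.
    apply: contra_neq x0 => /eqP; rewrite oppr_eq0 => /eqP u0.
    by rewrite -[x]vsubmxK -/u -/v v0 u0 col_mx0.
  rewrite v0 mulmx0 sub0r in qK *; rewrite subr_lt0.
  apply: le_lt_trans qK (le_lt_trans _ (sqnorm_gt0 u_neq0)).
  by rewrite oppr_le0 sqnorm_ge0.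
rewrite subr_lt0; apply: lt_le_trans (sqnorm_ge0 _); apply: le_lt_trans qK _.
by rewrite oppr_lt0 sqnorm_gt0.
Qed.

End LMI.

(** * Blocks, traces and phases of Hermitian matrices *)

Lemma hermsymm_rect (R : realType) (n m : nat) (Z : 'M[R[i]]_(n + m)) :
  Z \is hermsymmx -> primal_var (ulsubmx Z) (ursubmx Z) (drsubmx Z) = Z.
Proof.
move=> /hermsymmxP ZH; rewrite -[RHS]submxK /primal_var; congr block_mx.
by move: ZH; rewrite -{1 2}[Z]submxK ctrmx_block => /eq_block_mx[].
Qed.

Lemma hermsymm_submx (R : realType) (n m : nat) (Z : 'M[R[i]]_(n + m)) :
  Z \is hermsymmx -> ulsubmx Z \is hermsymmx /\ drsubmx Z \is hermsymmx.
Proof.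
move=> /hermsymmxP; rewrite -{1 2}[Z]submxK ctrmx_block.
by move=> /eq_block_mx[? _ _ ?]; split; apply/hermsymmxP.
Qed.

Lemma hermsymm_trE (R : realType) (n : nat) (M : 'M[R[i]]_n) :
  M \is hermsymmx -> \tr M = (complex.Re (\tr M))%:C.
Proof.
by move=> /hermsymmxP MH; apply: conj_real; rewrite -mxtrace_ctrmx MH.
Qed.

(** For Hermitian [M] the trace of [M *m M] is the squared Frobenius norm. *)
Lemma hermsymm_tr_sqr_le0 (R : realType) (n : nat) (M : 'M[R[i]]_n) :
  M \is hermsymmx -> complex.Re (\tr (M *m M)) <= 0 -> M = 0.
Proof.
move=> /hermsymmxP MH.
have -> : complex.Re (\tr (M *m M)) = \sum_i \sum_j complex.Re `|M i j| ^+ 2.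
  rewrite -{2}MH /mxtrace cRe_sum; apply: eq_bigr => i _.
  rewrite mxE cRe_sum; apply: eq_bigr => j _.
  by rewrite !mxE -normCK norm_cRe -rmorphXn.
move=> le0; apply/matrixP => i j; rewrite mxE; apply/eqP.
rewrite -normr_eq0 norm_cRe -[0]/(0%:C) (inj_eq (@complexI _)) -sqrf_eq0.
rewrite eq_le sqr_ge0 andbT; apply: le_trans le0.
rewrite (bigD1 i) //= (bigD1 j) //= -addrA lerDl addr_ge0 //.
  by apply: sumr_ge0 => ? _; rewrite sqr_ge0.
by do 2![apply: sumr_ge0 => ? _]; rewrite sqr_ge0.
Qed.

Lemma output_gramE (R : realType) (n m p : nat)
    (C : 'M[R[i]]_(p, n)) (D : 'M[R[i]]_(p, m)) :
  output_gram C D = (row_mx C D)^t* *m row_mx C D.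
Proof. by rewrite tr_row_mx map_col_mx mul_col_row. Qed.

Lemma hermsymm_phase (R : realType) (n : nat) (W : 'M[R[i]]_n) :
  W \is hermsymmx ->
  exists Y : 'M[R[i]]_n, [/\ Y \is hermsymmx, forall i j, `|Y i j| <= 1%:C
    & \tr (W *m Y) = \sum_i \sum_j `|W i j|].
Proof.
move=> /hermsymmxP WH.
have WC i j : Num.conj (W j i) = W i j by rewrite -[in RHS]WH !mxE.
(* The entrywise phase of [W], extremal for the pairing of the entrywise 1-norm and sup-norm;
   division by zero makes it 0 where [W] vanishes. *)
exists (\matrix_(i, j) (W i j / `|W i j|)); split=> [|i j|].
- apply/hermsymmxP/matrixP => i j; rewrite !mxE rmorphM /= WC.
  by rewrite fmorphV /= conj_normC -WC norm_conjC.
- rewrite mxE normrM normfV normr_id.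
  by have [->|w0] := eqVneq `|W i j| 0; rewrite ?mul0r ?ler01 ?mulfV.
- apply: eq_bigr => i _; rewrite mxE; apply: eq_bigr => j _.
  rewrite mxE -(WC j i) norm_conjC mulrA -normCK.
  by have [->|w0] := eqVneq `|W i j| 0; rewrite ?expr0n ?mul0r // expr2 mulfK.
Qed.

(** * The dual value as a sublinear function, and primal attainment *)

Section Duality.
Variables (R : realType) (n m k : nat).
Local Notation C := R[i].
Variables (A : 'M[C]_n) (B : 'M[C]_(n, m)).
Implicit Types (P X : 'M[C]_n) (Y W : 'M[C]_m) (M Z : 'M[C]_(n + m)).

(** Stating the constraint through [qform] gives it a meaning for every complex [M], as Hahn-Banach
    on the full matrix space requires; for Hermitian [M] it is the Loewner inequality. *)
Definition dual_cone M P Y (l t : R) : Prop :=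
  [/\ P \is hermsymmx, Y \is hermsymmx, 0 <= l /\ 0 <= t,
      forall i j, `|Y i j| <= t%:C
    & forall x, qform (lmi A B P Y l + M) x <= 0].

Definition dual_fun M : R :=
  inf [set v | exists P Y l t, dual_cone M P Y l t /\ v = l + k%:R * t].

Lemma dual_coneD M1 P1 Y1 l1 t1 M2 P2 Y2 l2 t2 :
  dual_cone M1 P1 Y1 l1 t1 -> dual_cone M2 P2 Y2 l2 t2 ->
  dual_cone (M1 + M2) (P1 + P2) (Y1 + Y2) (l1 + l2) (t1 + t2).
Proof.
move=> [hP1 hY1 [l10 t10] le1 q1] [hP2 hY2 [l20 t20] le2 q2]; split.
- exact: hermsymmD hP1 hP2.
- exact: hermsymmD hY1 hY2.
- by rewrite !addr_ge0.
- by move=> i j; rewrite mxE rmorphD (le_trans (ler_normD _ _)) // lerD.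
- move=> x; rewrite lmiD addrACA qformD.
  by rewrite -[0]addr0 lerD.
Qed.

Lemma dual_coneZ (a : R) M P Y l t : 0 < a ->
  dual_cone M P Y l t ->
  dual_cone (a%:C *: M) (a%:C *: P) (a%:C *: Y) (a * l) (a * t).
Proof.
move=> a0 [hP hY [l0 t0] le q]; split.
- exact: hermsymmZ.
- exact: hermsymmZ.
- by rewrite !mulr_ge0 // ltW.
- move=> i j; rewrite mxE normrM ger0_norm; last by rewrite ler0c ltW.
  by rewrite rmorphM ler_wpM2l // ler0c ltW.
- move=> x; rewrite lmiZ -scalerDr qformZ.
  by rewrite mulr_ge0_le0 // ltW.
Qed.

Hypothesis stableA : forall a, eigenvalue A a -> `|a| < 1.

Lemma dual_fun_has_inf M :
  has_inf [set v : R | exists P Y l t, dual_cone M P Y l t /\ v = l + k%:R * t].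
Proof.
split; last first.
  exists 0 => _ [P [Y [l [t [[_ _ [l0 t0] _ _] ->]]]]].
  by rewrite addr_ge0 // mulr_ge0.
(* The form of [M] is that of its Hermitian part [H], to which [lmi_neg_exists] applies; [Y] and [t]
   can then be 0. *)
pose H := (2^-1)%:C *: (M + M^t*).
have HH : H \is hermsymmx.
  by apply: hermsymmZ; apply/hermsymmxP; rewrite ctrmxD trmxCK addrC.
have [P [l [hP l0 lt0]]] := lmi_neg_exists B stableA HH.
exists (l + k%:R * 0), P, 0, l, 0; split=> //; split=> //.
- exact: hermsymm0.
- by rewrite ltW.
- by move=> i j; rewrite mxE normr0.
- move=> x; have [->|x0] := eqVneq x 0; first by rewrite /qform mulmx0 mxE.
  apply: ltW; apply: le_lt_trans (lt0 x x0).
  rewrite !qformD qformZ qformD qform_ctrmx lerD2l.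
  by move: (qform M x) => r; lra.
Qed.

Lemma dual_fun_le M P Y l t : dual_cone M P Y l t -> dual_fun M <= l + k%:R * t.
Proof.
move=> cM; apply: ge_inf; first by case: (dual_fun_has_inf M).
by exists P, Y, l, t.
Qed.

Lemma dual_fun_sublinear : sublinear dual_fun.
Proof.
split=> [M N|].
  rewrite -lerBlDr; apply: lb_le_inf; first by case: (dual_fun_has_inf M).
  move=> _ [P1 [Y1 [l1 [t1 [c1 ->]]]]]; rewrite lerBlDr -lerBlDl.
  apply: lb_le_inf; first by case: (dual_fun_has_inf N).
  move=> _ [P2 [Y2 [l2 [t2 [c2 ->]]]]]; rewrite lerBlDl.
  by have := dual_fun_le (dual_coneD c1 c2); lra.
have half a M : 0 < a -> dual_fun (a%:C *: M) <= a * dual_fun M.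
  move=> a0; rewrite -ler_pdivrMl //.
  apply: lb_le_inf; first by case: (dual_fun_has_inf M).
  move=> _ [P [Y [l [t [c ->]]]]]; rewrite ler_pdivrMl //.
  by have := dual_fun_le (dual_coneZ a0 c); lra.
move=> a M a0; apply/eqP; rewrite eq_le half //=.
have := half a^-1 (a%:C *: M); rewrite invr_gt0 => /(_ a0).
by rewrite scalerA -rmorphM mulVf ?gt_eqF // scale1r ler_pdivlMl.
Qed.

(** The matrix [Z] is the Hermitian part of the one representing the Hahn-Banach functional at
    [G]. *)
Lemma primal_attains G : G \is hermsymmx ->
  exists Z, [/\ Z \is hermsymmx,
    primal_feasible k A B (ulsubmx Z) (ursubmx Z) (drsubmx Z)
    & complex.Re (\tr (G *m Z)) = dual_fun G].
Proof.
move=> GH; have [Z1 [Z1le Z1G]] := hahn_banach_mx G dual_fun_sublinear.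
pose Z := (2^-1)%:C *: (Z1 + Z1^t*).
have ZH : Z \is hermsymmx.
  by apply: hermsymmZ; apply/hermsymmxP; rewrite ctrmxD trmxCK addrC.
have ZE M : M \is hermsymmx ->
    complex.Re (\tr (Z *m M)) = complex.Re (\tr (Z1 *m M)).
  move=> /hermsymmxP MH.
  have E : complex.Re (\tr (Z1^t* *m M)) = complex.Re (\tr (Z1 *m M)).
    by rewrite -{1}MH -ctrmxM mxtrace_ctrmx cRe_conj mxtrace_mulC.
  rewrite -scalemxAl linearZ /= cReMr mulmxDl [\tr (_ + _)]linearD cReD E.
  by lra.
have Zle M : M \is hermsymmx -> complex.Re (\tr (Z *m M)) <= dual_fun M.
  by move=> MH; rewrite ZE.
have [ZulH ZdrH] := hermsymm_submx ZH.
(* The test matrix is [- lmi A B P Y l], for which the point [(P, Y, l, t)] satisfies the dual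
   inequality with equality. All primal constraints but positivity follow from special choices of
   this point. *)
have Zlmi P Y l t : P \is hermsymmx -> Y \is hermsymmx -> 0 <= l -> 0 <= t ->
    (forall i j, `|Y i j| <= t%:C) ->
    - complex.Re (\tr (Z *m lmi A B P Y l)) <= l + k%:R * t.
  move=> PH YH l0 t0 Yt; have LH := lmi_hermsymm A B l PH YH.
  rewrite -cReN -[- \tr _]linearN /= -mulmxN.
  apply: le_trans (Zle _ (hermsymmN LH)) _; apply: (@dual_fun_le _ P Y).
  by split=> // x; rewrite subrr qform0.
have ZlmiE P Y l := congr1 (@complex.Re R) (mxtrace_lmi A B Z P Y l).
have lmi0 : lmi A B 0 0 0 = 0.
  rewrite lmiE mulmx0 mul0mx -[_%:M]scalemx1 scale0r addr0 /block_mx.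
  by rewrite !row_mx0 col_mx0 subr0.
have norm0 i j : `|(0 : 'M[C]_m) i j| <= 0%:C by rewrite mxE normr0.
exists Z; split; [exact: ZH| |by rewrite mxtrace_mulC ZE].
split.
- rewrite hermsymm_rect //.
  pose E := row_mx A B *m Z *m col_mx (A^t*) (B^t*) - ulsubmx Z.
  suff: E = 0 by move=> /eqP; rewrite subr_eq0 => /eqP.
  have EH : E \is hermsymmx.
    apply/hermsymmxP; rewrite ctrmxB !ctrmxM.
    rewrite (hermsymmxP _ ZulH) (hermsymmxP _ ZH).
    by rewrite tr_col_mx map_row_mx tr_row_mx map_col_mx !trmxCK mulmxA.
  apply: hermsymm_tr_sqr_le0 => //.
  (* Taking [P = - E] bounds the trace of [E *m E] by 0. *)
  have := Zlmi (- E) 0 0 0 (hermsymmN EH) (hermsymm0 _ _).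
  move=> /(_ (lexx _) (lexx _) norm0).
  rewrite ZlmiE mulmx0 mxtrace0 mul0r !subr0 -/E mulNmx.
  rewrite [\tr (- _)]linearN /= cReN.
  by lra.
- rewrite hermsymm_trE // -[1]/(1%:C) lecR.
  have := Zlmi 0 0 1 0 (hermsymm0 _ _) (hermsymm0 _ _) ler01 (lexx _) norm0.
  rewrite ZlmiE mulmx0 mxtrace0 mul0mx mxtrace0 mul1r subr0 sub0r cReN.
  by lra.
- set W := drsubmx Z.
  have [Y [YH Y1 WY]] := hermsymm_phase ZdrH.
  (* With [t = 1] and [Y] the phase of [W], the bound is exactly the 1-norm constraint. *)
  have := Zlmi 0 Y 0 1 (hermsymm0 _ _) YH (lexx _) ler01 Y1.
  rewrite ZlmiE mul0mx mxtrace0 mul0r subrr sub0r cReN opprK add0r mulr1 WY -/W.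
  move=> le_k.
  rewrite (_ : \sum_i _ = (complex.Re (\sum_i \sum_j `|W i j|))%:C).
    by rewrite -(rmorph_nat (real_complex R)) lecR.
  apply: conj_real; rewrite rmorph_sum; apply: eq_bigr => i _.
  by rewrite rmorph_sum; apply: eq_bigr => j _; rewrite /= conj_normC.
- rewrite /loewner_le subr0 hermsymm_rect //; apply/psdmxP; split=> // x.
  (* Positivity comes from testing at [- x x^*], where the zero dual point is admissible, so
     [dual_fun] is at most 0. *)
  have xH : - (x *m x^t*) \is hermsymmx.
    by apply: hermsymmN; apply/hermsymmxP; rewrite ctrmxM trmxCK.
  have := Zle _ xH; rewrite mulmxN [\tr (- _)]linearN /= cReN -qform_tr.
  have /dual_fun_le : dual_cone (- (x *m x^t*)) 0 0 0 0.
    split; [exact: hermsymm0|exact: hermsymm0|by []| |move=> y].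
      by move=> i j; exact: norm0.
    rewrite lmi0 add0r qformN -[x in x *m _]trmxCK qform_gram.
    by rewrite oppr_le0 sqnorm_ge0.
  by rewrite mulr0 addr0 => q0 /le_trans/(_ q0); rewrite oppr_le0.
Qed.

End Duality.

(** * Weak duality *)

Section WeakDuality.
Variables (R : realType) (n m p k : nat).
Local Notation C := R[i].
Variables (A : 'M[C]_n) (B : 'M[C]_(n, m)).
Variables (C1 : 'M[C]_(p, n)) (D : 'M[C]_(p, m)).

(** Pairing the primal variable with the dual inequality gives a nonpositive trace. The primal
    equation cancels the [P] term, [Tr W <= 1] bounds the [l] term, and the entrywise Hölder
    inequality bounds the [Y] term. *)
Lemma weak_duality X Q W P Y l t :
  primal_feasible k A B X Q W -> dual_feasible A B C1 D P Y l t ->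
  primal_objective C1 D X Q W <= l + k%:R * t.
Proof.
move=> [XE trW Wk]; rewrite /loewner_le subr0 => Zpsd.
move=> [[PH YH] [l0 t0 lm Yt]].
set Z := primal_var X Q W in XE Zpsd *.
have ulZ : ulsubmx Z = X by rewrite /Z /primal_var block_mxKul.
have drZ : drsubmx Z = W by rewrite /Z /primal_var block_mxKdr.
have := psdmx_trace_le0 Zpsd (M := dual_lmi A B C1 D P Y l).
have lm' x : qform (dual_lmi A B C1 D P Y l) x <= 0.
  by move/psdmxP: lm => [_ /(_ x)]; rewrite sub0r qformN oppr_ge0.
move=> /(_ lm'); rewrite /dual_lmi -/(lmi A B P Y l) mulmxDr.
rewrite [\tr (_ + _)]linearD /= cReD mxtrace_lmi ulZ drZ -XE subrr.
rewrite mulmx0 mxtrace0.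
rewrite /primal_objective -/Z [\tr (output_gram _ _ *m _)]mxtrace_mulC.
rewrite !cReD !cReN cReMr.
have := cRe_le trW; rewrite -[complex.Re 1]/(1 : R) => trW1.
have lW : l * complex.Re (\tr W) <= l by rewrite ler_piMr.
have WY : complex.Re (\tr (W *m Y)) <= k%:R * t.
  apply: le_trans (cRe_le_norm _) _; rewrite -lecR -norm_cRe.
  rewrite rmorphM rmorph_nat.
  apply: (@le_trans _ _ ((\sum_i \sum_j `|W i j|) * t%:C)); last first.
    by rewrite ler_wpM2r // ler0c.
  rewrite mulr_suml; apply: le_trans (ler_norm_sum _ _ _) _.
  apply: ler_sum => i _; rewrite mxE mulr_suml.
  apply: le_trans (ler_norm_sum _ _ _) _; apply: ler_sum => j _.
  by rewrite normrM ler_wpM2l.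
rewrite -[complex.Re 0]/(0 : R).
move: (complex.Re (\tr (Z *m _))) (complex.Re (\tr (W *m _))) WY => v w WY.
by move: (complex.Re (\tr W)) lW => tW lW; lra.
Qed.

End WeakDuality.

(** * Strict dual feasibility and zero gap *)

Theorem mainTheorem2 (R : realType) (n m p k : nat)
    (A : 'M[R[i]]_n) (B : 'M[R[i]]_(n, m))
    (C : 'M[R[i]]_(p, n)) (D : 'M[R[i]]_(p, m)) :
  (1 <= k <= m)%N ->
  spectral_radius A < 1 ->
  dual_strictly_feasible A B C D /\
  primal_value k A B C D = dual_value k A B C D.
Proof.
move=> _ rA.
have stA a : eigenvalue A a -> `|a| < 1 by exact: spectral_radius_lt1.
have GH : output_gram C D \is hermsymmx.
  by apply/hermsymmxP; rewrite output_gramE ctrmxM trmxCK.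
split.
  have [P [l [PH l0 lt0]]] := lmi_neg_exists B stA GH.
  (* With [Y = 0], the choice [t = 1] makes both the entrywise bound and the sign of [t] strict. *)
  exists P, 0, l, 1; split; first by split=> //; exact: hermsymm0.
  split=> // [|i j]; last by rewrite mxE normr0 ltcR.
  apply/pdmxP; rewrite sub0r; split; last first.
    by move=> x /lt0; rewrite qformN oppr_gt0.
  apply/hermsymmN/hermsymmD/GH/lmi_hermsymm => //; exact: hermsymm0.
apply/eqP; rewrite eq_le; apply/andP; split.
  apply: ge_ereal_sup => _ [X [Q [W [fX ->]]]].
  apply: le_ereal_inf_tmp => _ [P [Y [l [t [fP ->]]]]].
  by rewrite lee_fin; exact: weak_duality fX fP.
have [Z [ZH fZ ZE]] := primal_attains k B stA GH.
apply: (@le_trans _ _ (dual_fun k A B (output_gram C D))%:E); last first.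
  apply: ereal_sup_ubound; do 3!eexists; split; first exact: fZ.
  by rewrite /primal_objective hermsymm_rect // ZE.
(* The real infimum agrees with the extended one because its set is nonempty and bounded below; each
   point of [dual_cone] at the Gram matrix is dual feasible. *)
rewrite -ereal_inf_EFin; first last.
- by case: (dual_fun_has_inf k B stA (output_gram C D)).
- by case: (dual_fun_has_inf k B stA (output_gram C D)).
apply: ereal_inf_le_tmp => _ [v [P [Y [l [t [[PH YH [l0 t0] Yt q] ->]]]]] <-].
exists P, Y, l, t; split=> //; split=> //; split=> //.
rewrite /loewner_le; apply/psdmxP; rewrite sub0r; split.
  exact/hermsymmN/hermsymmD/GH/lmi_hermsymm.
by move=> x; rewrite qformN oppr_ge0; exact: q.
Qed.
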